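(* Let $w[1..n]$ be a string. For each position $1\le i\le n$, let $r_1,\ldots,r_{K_i}$ be all the maximal right-closed occurrences in $w$ starting at $i$, with $|r_1|<\cdots<|r_{K_i}|$, and for each $j$ let $p_j$ be the shortest closed prefix of $r_j$ such that either $p_j=r_j$ or $p_j$ is right-extendible to $r_j$. Define $$\mathcal{C}(w)=\{(i,|p_j|,|r_j|)\mid 1\le i\le n,\ 1\le j\le K_i\}.$$ Then $\mathcal{C}(w)$ is a compact representation of all closed substrings of $w$: the set of closed substrings of $w$ equals $\bigcup_{(i,|p_j|,|r_j|)\in\mathcal{C}(w)}\{w[i..i+\ell-1]\mid \ell\in[|p_j|,|r_j|]\}$, and $\mathcal{C}(w)$ has size $\mathcal{O}(n\log n)$.
   Context: Strings are indexed from 1; $w[i..j]$ denotes the substring (occurrence) of $w$ from position $i$ to $j$. A border of a string $x$ is a nonempty string that is both a proper prefix and a proper suffix of $x$. A string $x$ is closed if $|x|=1$, or $|x|\ge2$ and $x$ has a border occurring in $x$ only as a prefix and as a suffix and nowhere else (equivalently, the longest border of $x$ has no internal occurrence in $x$). An occurrence $w[i..j]$ is maximal right-closed if it is closed and either $j=n$ or $w[i..j+1]$ is not closed. A closed occurrence $u=w[i..j]$ is right-extendible to a maximal right-closed occurrence $r=w[i..j']$ if $j<j'\le n$ and every prefix $w[i..k]$ of $r$ with $j<k<j'$ is closed. *)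

(* Defs.v *)
From mathcomp Require Import all_boot all_order all_algebra.
From mathcomp Require Import finmap.
From mathcomp Require Import all_classical all_reals all_analysis.

Set Implicit Arguments.
Unset Strict Implicit.
Unset Printing Implicit Defensive.

Local Open Scope classical_set_scope.

Section ClosedSubstrings.
Variable T : eqType.
Implicit Types (w x b : seq T) (i j k : nat).

(* w[i..j], with positions numbered from 1; only meaningful when
   1 <= i <= j <= size w, see [occurrence]. *)
Definition substr w i j : seq T := drop i.-1 (take j w).

Definition occurrence w i j : Prop := 1 <= i <= j /\ j <= size w.

Definition border b x : Prop :=
  [/\ b != [::], prefix b x, suffix b x & b != x].

Definition occurs_at b x k : Prop :=
  occurrence x k (k + size b - 1) /\ substr x k (k + size b - 1) = b.

Definition closed_string x : Prop :=
  size x = 1 \/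
  2 <= size x /\
  exists2 b, border b x &
    forall k, occurs_at b x k -> k = 1 \/ k = size x - size b + 1.

Definition closed_occ w i j : Prop :=
  occurrence w i j /\ closed_string (substr w i j).

Definition max_right_closed w i j : Prop :=
  closed_occ w i j /\ (j = size w \/ ~ closed_string (substr w i j.+1)).

Definition right_extendible w i j j' : Prop :=
  [/\ closed_occ w i j, max_right_closed w i j', j < j' <= size w &
      forall k, j < k < j' -> closed_occ w i k].

(* The condition that the shortest closed prefix p = w[i..j] of
   r = w[i..j'] minimizes. *)
Definition extends_to w i j j' : Prop :=
  [/\ closed_occ w i j, j <= j' & j = j' \/ right_extendible w i j j'].

Definition shortest_extending w i j j' : Prop :=
  extends_to w i j j' /\ forall k, extends_to w i k j' -> j <= k.

(* Maximal right-closed occurrences starting at the same position are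
   determined by their length, so their enumeration r_1, ..., r_{K_i} is
   replaced by a quantification over all their end positions j'. *)
Definition closed_repr w : set (nat * nat * nat) :=
  [set t | exists i j j',
    [/\ 1 <= i <= size w, max_right_closed w i j',
        shortest_extending w i j j' &
        t = (i, size (substr w i j), size (substr w i j'))]].

Definition closed_occs w : set (nat * nat) :=
  [set o | closed_occ w o.1 o.2].

Definition closed_substrings w : set (seq T) :=
  [set substr w o.1 o.2 | o in closed_occs w].

End ClosedSubstrings.

(* Main.v *)
(** A maximal right-closed occurrence of length at least 2 starting at [a] is
    given by a pair [a < q]: its border has the length [l] of the longest common
    extension of [a] and [q], and [q] is the first position after [a] where the
    block of [l] letters at [a] reoccurs; dually [a] is the last such position
    before [q].  Call [l] light at [x] if, among the positions matching [x] on
    [l] letters, at most half still match it on [l+1] letters; each position has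
    at most log2 n light levels.  Since [a] and [q] separate between [l] and
    [l+1], the level [l] is light at [a] or at [q]; as [l] and either endpoint
    determine the other, there are at most 2 n log2 n such pairs. *)
Require Import Defs.
From mathcomp Require Import all_boot all_order all_algebra.
From mathcomp Require Import finmap zify ring.
From mathcomp Require Import all_classical all_reals all_analysis.

Import Order.TTheory GRing.Theory Num.Theory.
Import numFieldNormedType.Exports.

Local Open Scope classical_set_scope.
Local Open Scope nat_scope.

Set Implicit Arguments.
Unset Strict Implicit.

(** * Two counting bounds *)

Lemma size_allpairs_dep_le (S : eqType) (T R : Type) (f : S -> T -> R)
    (s : seq S) (t : S -> seq T) (k : nat) :
  {in s, forall x, size (t x) <= k} ->
  size [seq f x y | x <- s, y <- t x] <= size s * k.
Proof.
rewrite size_allpairs_dep; elim: s => //= x s IHs tk.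
rewrite mulSn leq_add ?tk ?mem_head // IHs // => y ys.
by rewrite tk // in_cons ys orbT.
Qed.

(** Each halving level contributes a factor 2 to the descent from [f 0] to [f m]; at the other
    levels monotonicity suffices. *)
Lemma halving_count (f : nat -> nat) (m : nat) :
  (forall l, f l.+1 <= f l) ->
  2 ^ count (fun l => 2 * f l.+1 <= f l) (iota 0 m) * f m <= f 0.
Proof.
move=> fS; elim: m => [|m IHm]; first by rewrite /= expn0 mul1n.
apply: leq_trans IHm; rewrite -[iota 0 m.+1]/(iota 0 (1 + m)) addnC iotaD count_cat /= add0n addn0.
case: (leqP (2 * f m.+1) (f m)) => [h|_] /=; rewrite ?addn0 ?addn1 ?expnSr -?mulnA leq_mul2l.
  by rewrite h orbT.
by rewrite fS orbT.
Qed.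

(** * Block matches, their classes and light levels *)

Section Blocks.
Variables (T : eqType) (w : seq T).
Implicit Types (l a b k q i j : nat).

(* Blocks are truncated at the end of [w]; two truncated blocks at different
   positions have different sizes, so the relation is an equivalence that
   amounts to a genuine match of [l] letters between distinct positions. *)
Definition same_block l a b := take l (drop a w) == take l (drop b w).

(* Positions are numbered from 0, as in [drop]: this is the occurrence
   w[a+1..q+l] of the paper, with longest border of length [l]. *)
Definition next_match l a q :=
  [/\ a < q < size w, same_block l a q, ~~ same_block l.+1 a q
    & forall k, a < k < q -> ~~ same_block l a k].

Definition block_class l a := count (same_block l a) (iota 0 (size w)).

Definition light_levels a :=
  [seq l <- iota 0 (size w) | 2 * block_class l.+1 a <= block_class l a].

Lemma same_block_refl l a : same_block l a a.
Proof. exact: eqxx. Qed.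

Lemma same_block_sym l a b : same_block l a b = same_block l b a.
Proof. exact: eq_sym. Qed.

Lemma same_block_trans l a b k :
  same_block l a b -> same_block l b k -> same_block l a k.
Proof. by move=> /eqP ab /eqP bk; rewrite /same_block ab bk. Qed.

Lemma same_blockW l m a b : l <= m -> same_block m a b -> same_block l a b.
Proof.
move=> lm /eqP ab; rewrite /same_block -(take_takel _ lm) -[X in _ == X](take_takel _ lm).
by rewrite ab.
Qed.

Lemma same_block_size l a b : a < b -> b <= size w -> same_block l a b ->
  b + l <= size w.
Proof.
move=> ab bw /eqP /(congr1 size); rewrite !size_take !size_drop.
by case: ifP; case: ifP; lia.
Qed.

Lemma next_match_uniqr l a q q' : next_match l a q -> next_match l a q' -> q = q'.
Proof.
move=> [aq e _ h] [aq' e' _ h']; case: (ltngtP q q') => // lt.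
  by move: (h' q); rewrite e lt; case/andP: aq => -> _ /(_ isT).
by move: (h q'); rewrite e' lt; case/andP: aq' => -> _ /(_ isT).
Qed.

(** If [a < a'] both led to [q], then [a] would match [a'] by transitivity through [q], so [q] would
    not be the first recurrence after [a]. *)
Lemma next_match_uniql l a a' q : next_match l a q -> next_match l a' q -> a = a'.
Proof.
have H b b' : next_match l b q -> next_match l b' q -> ~~ (b < b').
  move=> [_ e _ h] [/andP[bq _] e' _ _]; apply/negP => lt.
  move: (h b'); rewrite lt bq => /(_ isT)/negP; apply.
  by apply: same_block_trans e _; rewrite same_block_sym.
by move=> m m'; move: (H _ _ m m') (H _ _ m' m); case: ltngtP.
Qed.

Lemma block_classS l a : block_class l.+1 a <= block_class l a.
Proof. by apply: sub_count => b; exact: same_blockW. Qed.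

Lemma block_class_gt0 l a : a < size w -> 0 < block_class l a.
Proof.
move=> aw; rewrite -has_count; apply/hasP; exists a; last exact: same_block_refl.
by rewrite mem_iota.
Qed.

(** The class of [a] starts with at most [size w] positions and always contains [a], so it can halve
    at most log2 ([size w]) times. *)
Lemma size_light_levels a : a < size w ->
  size (light_levels a) <= trunc_log 2 (size w).
Proof.
move=> aw; apply: trunc_log_max => //; rewrite size_filter.
have := halving_count (size w) (block_classS ^~ a).
set c := count _ _ => h; rewrite -[2 ^ c]muln1.
apply: leq_trans (_ : 2 ^ c * block_class (size w) a <= _).
  by rewrite leq_mul2l block_class_gt0 ?orbT.
by apply: leq_trans h _; rewrite -[X in _ <= X](size_iota 0) count_size.
Qed.

Lemma block_class_eq l a b : same_block l a b -> block_class l a = block_class l b.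
Proof.
move=> ab; apply: eq_count => k; apply/idP/idP; last exact: same_block_trans.
by apply: same_block_trans; rewrite same_block_sym.
Qed.

(* The classes of [a] and [q] at level [l.+1] are disjoint parts of their
   common class at level [l], so one of them is at most half of it. *)
Lemma next_match_light l a q : next_match l a q ->
  l \in light_levels a \/ l \in light_levels q.
Proof.
move=> [/andP[aq qw] e ne _].
have lw : l < size w by have := same_block_size aq (ltnW qw) e; lia.
rewrite !mem_filter !mem_iota /= add0n lw !andbT -(block_class_eq e).
suff : block_class l.+1 a + block_class l.+1 q <= block_class l a by lia.
rewrite /block_class -count_predUI (@eq_in_count _ (predI _ _) pred0); last first.
  move=> k _ /=; apply/negP => /andP[ak qk]; case/negP: ne.
  by apply: same_block_trans ak _; rewrite same_block_sym.
rewrite count_pred0 addn0; apply: sub_count => k /=.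
case/orP => /(same_blockW (leqnSn l)) //; exact: same_block_trans.
Qed.

(** * Closed substrings in terms of block matches *)

Lemma substrE (x : seq T) i j : substr x i j = take (j - i.-1) (drop i.-1 x).
Proof.
rewrite /substr take_drop; case: (leqP i.-1 j) => h; first by rewrite subnK.
by rewrite !drop_oversize // size_take_min; lia.
Qed.

Lemma take_drop_take l k m (x : seq T) :
  k + l <= m -> take l (drop k (take m x)) = take l (drop k x).
Proof.
by move=> klm; rewrite !take_drop; congr drop; rewrite take_takel // addnC.
Qed.

(** Here [l] is the length of the border and [q] the start, counted from 0, of its last occurrence;
    the absence of internal occurrences makes [q] the first recurrence of the block at [a]. The two
    occurrences may overlap. *)
Lemma closed_stringP a m : 2 <= m -> a + m <= size w ->
  closed_string (take m (drop a w)) <->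
  exists q l, [/\ a < q, 0 < l, q + l = a + m, same_block l a q
    & forall k, a < k < q -> ~~ same_block l a k].
Proof.
move=> m2 amw; set x := take m _.
have xm : size x = m by rewrite size_takel // size_drop; lia.
have xw l k : k + l <= m -> take l (drop k x) = take l (drop (a + k) w).
  by move=> klm; rewrite take_drop_take // drop_drop addnC.
split.
  case=> [|[_ [b [b0 pbx sbx bx] occ]]]; first by rewrite xm => m1; lia.
  have l0 : 0 < size b by rewrite lt0n size_eq0.
  have lm : size b < m.
    rewrite -xm ltn_neqAle size_prefix // andbT; apply: contra bx => /eqP bx.
    by move: pbx; rewrite prefixE bx take_size eq_sym.
  have bE : take (size b) (drop a w) = b.
    by apply/eqP; rewrite -[a]addn0 -xw ?drop0 -?prefixE //; lia.
  exists (a + (m - size b)), (size b); split=> //; try lia.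
    rewrite /same_block bE -xw; last lia.
    by move: sbx; rewrite suffixE xm => /eqP ->; rewrite take_size.
  move=> k /andP[ak kq]; apply/negP; rewrite /same_block bE => /eqP kb.
  (* Offset [k - a] in [x] is position [(k - a).+1] when counted from 1. *)
  have [|k1|k2] := occ (k - a).+1; [|lia|rewrite xm in k2; lia].
  split; first by rewrite /occurrence xm; lia.
  rewrite substrE /= (_ : _ - _ = size b) ?xw; try lia.
  by rewrite subnKC // ltnW.
move=> [q [l [aq l0 qlm e h]]]; right; rewrite xm; split=> //.
have lE : size (take l x) = l by rewrite size_takel // xm; lia.
have bE : take l x = take l (drop a w) by rewrite -[x]drop0 xw ?addn0 //; lia.
exists (take l x); rewrite ?lE.
  split; first by rewrite -size_eq0 lE -lt0n.
  - by rewrite prefixE lE.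
  - rewrite suffixE lE xm -[drop _ _](@take_oversize _ l).
      rewrite xw; last lia.
      by rewrite bE (_ : a + (m - l) = q) 1?eq_sym //; lia.
    by rewrite size_drop xm; lia.
  - by apply/eqP => /(congr1 size); rewrite lE xm; lia.
move=> k [[]]; rewrite lE xm => k1 k2.
rewrite substrE (_ : k + l - 1 - k.-1 = l); last lia.
rewrite xw ?bE; last lia; move=> /eqP kb.
case: (k =P 1) => [|kn1]; [by left|right].
have : ~~ (a < a + k.-1 < q) by apply/negP => /h /negP; apply; rewrite /same_block eq_sym.
lia.
Qed.

Lemma closed_occE i j : closed_occ w i j <->
  occurrence w i j /\ (i = j \/ i < j /\
  exists q l, [/\ i.-1 < q, 0 < l, q + l = j, same_block l i.-1 q
    & forall k, i.-1 < k < q -> ~~ same_block l i.-1 k]).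
Proof.
rewrite /closed_occ; split=> -[ij c]; split=> //; move: (ij) => [/andP[i1 jj] jw].
  case: (ltngtP i j) => [lt|lt|->]; [right; split=> // |lia|by left].
  move: c; rewrite substrE closed_stringP; try lia.
  by rewrite subnKC //; lia.
case: c => [<-|[lt c]].
  by left; rewrite substrE size_takel ?size_drop; lia.
rewrite substrE; apply/closed_stringP; try lia.
by rewrite subnKC //; lia.
Qed.

Lemma max_right_closed_next_match i j : max_right_closed w i j ->
  i = j \/ exists q l, q + l = j /\ next_match l i.-1 q.
Proof.
move=> [/closed_occE [[/andP[i1 ij] jw]] [->|[lt [q [l [iq l0 qlj e h]]]]] mx].
  by left.
right; exists q, l; split=> //; split=> //; first by lia.
(* A match on [l.+1] letters would fit in [w], forcing [j < size w], and [q] would still be the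
   first recurrence, so the occurrence ending at [j.+1] would be closed. *)
apply/negP => e'; have := same_block_size iq _ e' => jw'.
case: mx => [|]; first by lia.
have /closed_occE : occurrence w i j.+1 /\ (i = j.+1 \/ i < j.+1 /\
  exists q l, [/\ i.-1 < q, 0 < l, q + l = j.+1, same_block l i.-1 q
    & forall k, i.-1 < k < q -> ~~ same_block l i.-1 k]).
  split; first by rewrite /occurrence; lia.
  right; split; first lia.
  exists q, l.+1; split=> //; first by lia.
  by move=> k /h; apply: contra; exact: same_blockW.
by case.
Qed.

(** * Runs of closed occurrences with a common start *)

Lemma size_substr i j : occurrence w i j -> size (substr w i j) = j - i.-1.
Proof. by move=> [ij jw]; rewrite substrE size_takel // size_drop; lia. Qed.

Lemma closed_occ_max i j : closed_occ w i j ->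
  exists j', [/\ j <= j', max_right_closed w i j'
    & forall k, j <= k <= j' -> closed_occ w i k].
Proof.
have [m] := ubnP (size w - j); elim: m j => // m IHm j mj c.
have [[/andP[i1 ij] jw] _] := c.
have [cS|ncS] := pselect (j < size w /\ closed_string (substr w i j.+1)).
  have [||j' [jj' mx h]] := IHm j.+1; first by lia.
    by case: cS => jw' cS; split=> //; rewrite /occurrence; lia.
  exists j'; split=> //; first by lia.
  by move=> k /andP[jk kj']; have [->//|kj] := eqVneq k j; apply: h; lia.
exists j; split=> // [|k kj]; last by have -> : k = j by lia.
split=> //; case: (eqVneq j (size w)) => jw'; [by left|right => cS].
by apply: ncS; split=> //; lia.
Qed.

Lemma shortest_extending_exists i j j' : extends_to w i j j' ->
  exists2 k, k <= j & shortest_extending w i k j'.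
Proof.
move=> e; have ex : exists k, `[< extends_to w i k j' >] by exists j; apply/asboolP.
case: (ex_minnP ex) => k /asboolP ek mn; exists k.
  by apply: mn; apply/asboolP.
by split=> // m em; apply: mn; apply/asboolP.
Qed.

(** For a fixed start, the ends of closed occurrences split into runs of consecutive integers; each
    triple records the shortest and longest lengths of one run. *)
Lemma closed_occs_bigcup :
  closed_occs w = \bigcup_(t in closed_repr w)
    [set (t.1.1, t.1.1 + l - 1) | l in [set l | t.1.2 <= l <= t.2]].
Proof.
apply/seteqP; split=> [[i j]|o [_ [i [j [j' [iw mx [ext _] ->]]]]] /=].
  rewrite {1}/closed_occs /= => c; have [j' [jj' mx h]] := closed_occ_max c.
  have [|k kj sh] := @shortest_extending_exists i j j'.
    split=> //; have [->|jj] := eqVneq j j'; [by left|right; split=> //].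
      by have [[_ ?] _] := mx.1; lia.
    by move=> k jkj'; apply: h; lia.
  have [ij jw] := c.1; have kc := sh.1; case: (kc) => [[ok _] _ _].
  exists (i, size (substr w i k), size (substr w i j')).
    by exists i, k, j'; split=> //; lia.
  have := ok; rewrite /occurrence => -[? ?].
  exists (j - i.-1) => /=; last by congr pair; lia.
  by rewrite !size_substr //; [lia|exact: mx.1.1].
have [cj jj' jext] := ext; move=> [l].
have oj := cj.1; have oj' := mx.1.1.
rewrite !size_substr // => /andP[l1 l2] <- /=.
move: (oj) (oj'); rewrite /occurrence => -[? ?] [? ?].
have [lj|lj] := eqVneq (i + l - 1) j; first by rewrite lj.
have [lj'|lj'] := eqVneq (i + l - 1) j'; first by rewrite lj'; exact: mx.1.
case: jext => [jj|[_ _ _ h]]; first by exfalso; lia.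
by rewrite /closed_occs /=; apply: h; lia.
Qed.

(** * Charging triples to light levels *)

Lemma closed_repr_inj t t' : closed_repr w t -> closed_repr w t' ->
  t.1.1 = t'.1.1 -> t.2 = t'.2 -> t = t'.
Proof.
move=> [i [j [k [_ mk [ej sj] ->]]]] [i' [j' [k' [_ mk' [ej' sj'] ->]]]] /= ii.
subst i'; have ok := mk.1.1; have ok' := mk'.1.1; have [[oj _] _ _] := ej.
have [[oj' _] _ _] := ej'; rewrite !size_substr // => kk.
move: (ok) (ok'); rewrite /occurrence => -[? _] [? _].
have {}kk : k' = k by lia.
(* Once [r] is fixed, minimality in both directions fixes [p]. *)
by subst k'; have -> : j' = j by apply/eqP; rewrite eqn_leq sj ?sj'.
Qed.

Definition charged_left a l : set (nat * nat * nat) :=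
  [set t | closed_repr w t /\
    exists q, [/\ next_match l a q, t.1.1 = a.+1 & t.2 = q + l - a]].

Definition charged_right q l : set (nat * nat * nat) :=
  [set t | closed_repr w t /\
    exists a, [/\ next_match l a q, t.1.1 = a.+1 & t.2 = q + l - a]].

Lemma charged_left_uniq a l t t' :
  charged_left a l t -> charged_left a l t' -> t = t'.
Proof.
move=> [ct [q [m t1 t2]]] [ct' [q' [m' t1' t2']]].
by apply: closed_repr_inj => //; rewrite ?t1 ?t1' ?t2 ?t2' ?(next_match_uniqr m m').
Qed.

Lemma charged_right_uniq q l t t' :
  charged_right q l t -> charged_right q l t' -> t = t'.
Proof.
move=> [ct [a [m t1 t2]]] [ct' [a' [m' t1' t2']]].
by apply: closed_repr_inj => //; rewrite ?t1 ?t1' ?t2 ?t2' ?(next_match_uniql m m').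
Qed.

(* [charged_left] and [charged_right] hold of at most one triple, so [xget]
   recovers it; where there is none it returns the junk triple [(0, 0, 0)]. *)
Definition charges : seq (nat * nat * nat) :=
  [seq (i, 1, 1) | i <- iota 1 (size w)] ++
  [seq xget (0, 0, 0) (charged_left a l) | a <- iota 0 (size w), l <- light_levels a] ++
  [seq xget (0, 0, 0) (charged_right q l) | q <- iota 0 (size w), l <- light_levels q].

Lemma size_charges : size charges <= size w * (trunc_log 2 (size w)).*2.+1.
Proof.
have lt : {in iota 0 (size w), forall a, size (light_levels a) <= trunc_log 2 (size w)}.
  by move=> a; rewrite mem_iota => /size_light_levels.
rewrite /charges !size_cat size_map size_iota mulnS leq_add2l -addnn mulnDr.
by apply: leq_add; rewrite -[X in _ <= X * _](size_iota 0) size_allpairs_dep_le.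
Qed.

Lemma closed_repr_charges t : closed_repr w t -> t \in charges.
Proof.
move=> ct; have [i [j [k [iw mk sj tE]]]] := ct.
have [ok _] := mk.1; have [ik kw] := ok; have [[cj jk _] _] := sj.
have [oj _] := cj; have [ij jw] := oj.
rewrite /charges !mem_cat.
have [ik'|[q [l [qlk m]]]] := max_right_closed_next_match mk.
  (* If [r] is a single letter, then so is [p], and the triple is [(i, 1, 1)]. *)
  apply/orP; left; apply/mapP; exists i; first by rewrite mem_iota; lia.
  by rewrite tE !size_substr //; congr (_, _, _); lia.
have t1 : t.1.1 = i.-1.+1 by rewrite tE /=; lia.
have t2 : t.2 = q + l - i.-1 by rewrite tE /= size_substr // qlk.
have [/andP[iq qw] _ _ _] := m.
apply/orP; right; have [lt|lt] := next_match_light m; apply/orP.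
  left; apply/allpairsPdep; exists i.-1, l; split=> //.
    by rewrite mem_iota; lia.
  have ch : charged_left i.-1 l t by split=> //; exists q.
  exact: charged_left_uniq ch (xgetI _ ch).
right; apply/allpairsPdep; exists q, l; split=> //.
  by rewrite mem_iota.
have ch : charged_right q l t by split=> //; exists i.-1.
exact: charged_right_uniq ch (xgetI _ ch).
Qed.

Lemma card_closed_repr : finite_set (closed_repr w) /\
  #|` fset_set (closed_repr w)| <= size w * (trunc_log 2 (size w)).*2.+1.
Proof.
have fin : finite_set (closed_repr w).
  by apply: sub_finite_set (finite_seq charges) => t /closed_repr_charges.
split=> //; apply: leq_trans size_charges.
apply: uniq_leq_size => [|t]; first exact: fset_uniq.
by rewrite in_fset_set // inE => /closed_repr_charges.
Qed.

End Blocks.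

(** * From the binary logarithm to the asymptotic bound *)

Local Open Scope ring_scope.

Lemma trunc_log_ln (R : realType) (n : nat) : (0 < n)%N ->
  (trunc_log 2 n)%:R * ln 2 <= ln n%:R :> R.
Proof.
move=> n0; rewrite mulr_natl -lnXn ?ltr0n // ler_ln ?posrE ?exprn_gt0 ?ltr0n //.
by rewrite -natrX ler_nat trunc_logP.
Qed.

Unset Implicit Arguments.

Theorem theorem1 (R : realType) :
  (forall (T : eqType) (w : seq T),
     closed_occs w =
       \bigcup_(t in closed_repr w)
         [set (t.1.1, (t.1.1 + l - 1)%N) | l in [set l | (t.1.2 <= l <= t.2)%N]]
     /\
     closed_substrings w =
       \bigcup_(t in closed_repr w)
         [set substr w t.1.1 (t.1.1 + l - 1)%N
            | l in [set l | (t.1.2 <= l <= t.2)%N]])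
  /\
  (exists c : R, \forall n \near \oo,
     forall (T : eqType) (w : seq T), size w = n ->
       finite_set (closed_repr w) /\
       (#|` fset_set (closed_repr w)|)%:R <= c * (n%:R * ln n%:R)).
Proof.
split=> [T w|].
  split; first exact: closed_occs_bigcup.
  rewrite /closed_substrings closed_occs_bigcup image_bigcup.
  by apply: eq_bigcupr => t _; rewrite image_comp.
have ln2 : 0 < ln 2 :> R by rewrite ln_gt0 ?ltr1n.
(* For [n] at least 2, [trunc_log 2 n] is at least 1, so twice it plus one is at most three times
   it; dividing by [ln 2] changes the base. *)
exists (3 / ln 2); near=> n => T w wn.
have n2 : (2 <= n)%N by near: n; exact: nbhs_infty_ge.
have [fin le] := card_closed_repr w; split=> //.
rewrite wn in le.
have log1 : (1 <= trunc_log 2 n)%N by rewrite trunc_log_max.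
have le3 : (#|` fset_set (closed_repr w)| <= n * (3 * trunc_log 2 n))%N.
  by apply: leq_trans le _; rewrite leq_mul2l; apply/orP; right; lia.
apply: le_trans (_ : (n * (3 * trunc_log 2 n))%:R <= _); first by rewrite ler_nat.
have -> : 3 / ln 2 * (n%:R * ln n%:R) = n%:R * (3 * (ln n%:R / ln 2)) :> R by ring.
by rewrite !natrM !ler_wpM2l ?ler0n // ler_pdivlMr // trunc_log_ln // ltnW.
Unshelve. all: by end_near.
Qed.
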